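(* (a) There exist infinitely many strongly connected digraphs $D$ with $\overrightarrow{trc}(D)=\overrightarrow{strc}(D)=\overrightarrow{rc}(D)=\overrightarrow{src}(D)=3$. (b) Given $s\ge 13$, there exists a strongly connected digraph $D$ with $\overrightarrow{trc}(D)=\overrightarrow{rvc}(D)=s$. (c) Given $s\ge 13$, there exists a strongly connected digraph $D$ with $\overrightarrow{strc}(D)=\overrightarrow{srvc}(D)=s$.
   Context: All digraphs are finite, without loops and without multiple arcs; strongly connected means every ordered pair $(u,v)$ is joined by a directed $u$–$v$ path; a geodesic is a shortest directed path. An arc-coloured path is rainbow if its arcs have distinct colours; a vertex-coloured path is vertex-rainbow if its internal vertices have distinct colours; a total-coloured path is total-rainbow if its arcs and internal vertices all receive pairwise distinct colours. $\overrightarrow{rc}(D)$, $\overrightarrow{src}(D)$: minimum number of colours in an arc-colouring such that every ordered pair $(u,v)$ is joined by a rainbow path, resp. rainbow geodesic. $\overrightarrow{rvc}(D)$, $\overrightarrow{srvc}(D)$: minimum number of colours in a vertex-colouring such that every ordered pair is joined by a vertex-rainbow path, resp. geodesic. $\overrightarrow{trc}(D)$, $\overrightarrow{strc}(D)$: minimum number of colours in a total-colouring (of vertices and arcs) such that every ordered pair is joined by a total-rainbow path, resp. geodesic. *)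

(* Defs.v *)
From mathcomp Require Import all_boot.
From mathcomp Require Import boolp classical_sets.

Set Implicit Arguments.
Unset Strict Implicit.
Unset Printing Implicit Defensive.

(* Opposite arcs [arc x y] and [arc y x] may coexist. *)
Record digraph := Digraph {
  vert :> finType;
  arc : rel vert;
  arc_irr : irreflexive arc
}.

Definition isomorphic (D E : digraph) : Prop :=
  exists f : D -> E, bijective f /\ forall x y, arc (f x) (f y) = arc x y.

Definition strongly_connected (D : digraph) : Prop :=
  forall u v : D, connect (@arc D) u v.

(* A directed path with initial vertex [u] is given by [u] and the sequence [p]
   of its subsequent vertices. *)
Definition dipath (D : digraph) (u v : D) (p : seq D) : bool :=
  [&& path (@arc D) u p, last u p == v & uniq (u :: p)].

Definition geodesic (D : digraph) (u v : D) (p : seq D) : Prop :=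
  dipath u v p /\ forall q, dipath u v q -> size p <= size q.

Definition internal (D : digraph) (u : D) (p : seq D) : seq D :=
  behead (belast u p).

Definition joined_by_paths (D : digraph) (good : D -> seq D -> bool) : Prop :=
  forall u v : D, exists2 p, dipath u v p & good u p.

Definition joined_by_geodesics (D : digraph) (good : D -> seq D -> bool) : Prop :=
  forall u v : D, exists2 p, geodesic u v p & good u p.

(* The colours are 0, ..., k - 1; the value of [c] on a non-arc is irrelevant. *)
Definition arc_colouring (D : digraph) (k : nat) (c : D -> D -> nat) : Prop :=
  forall x y : D, arc x y -> c x y < k.

Definition vertex_colouring (D : digraph) (k : nat) (c : D -> nat) : Prop :=
  forall x : D, c x < k.

Definition rainbow (D : digraph) (c : D -> D -> nat) (u : D) (p : seq D) : bool :=
  uniq (pairmap c u p).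

Definition vertex_rainbow (D : digraph) (c : D -> nat) (u : D) (p : seq D) : bool :=
  uniq (map c (internal u p)).

Definition total_rainbow (D : digraph) (ca : D -> D -> nat) (cv : D -> nat)
    (u : D) (p : seq D) : bool :=
  uniq (pairmap ca u p ++ map cv (internal u p)).

(* The junk value, when no [k] satisfies [P], is 0; for the parameters below it
   is not used when the digraph is strongly connected, since one may give all
   vertices and arcs distinct colours. *)
Definition least (P : nat -> Prop) : nat :=
  xget 0 [set k | P k /\ forall j, P j -> k <= j]%classic.

Lemma leastP (P : nat -> Prop) :
  (exists k, P k) -> P (least P) /\ forall j, P j -> least P <= j.
Proof.
move=> [k0 Pk0].
have exP : exists k, `[< P k >] by exists k0; apply/asboolP.
rewrite /least; case: xgetP => [k _ //|nP].
case: (ex_minnP exP) => m /asboolP Pm min_m.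
by case: (nP m); split=> // j /asboolP; apply: min_m.
Qed.

Definition rc (D : digraph) : nat := least (fun k =>
  exists c : D -> D -> nat,
    arc_colouring k c /\ joined_by_paths (rainbow c)).

Definition src (D : digraph) : nat := least (fun k =>
  exists c : D -> D -> nat,
    arc_colouring k c /\ joined_by_geodesics (rainbow c)).

Definition rvc (D : digraph) : nat := least (fun k =>
  exists c : D -> nat,
    vertex_colouring k c /\ joined_by_paths (vertex_rainbow c)).

Definition srvc (D : digraph) : nat := least (fun k =>
  exists c : D -> nat,
    vertex_colouring k c /\ joined_by_geodesics (vertex_rainbow c)).

Definition trc (D : digraph) : nat := least (fun k =>
  exists (ca : D -> D -> nat) (cv : D -> nat),
    [/\ arc_colouring k ca, vertex_colouring k cv
      & joined_by_paths (total_rainbow ca cv)]).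

Definition strc (D : digraph) : nat := least (fun k =>
  exists (ca : D -> D -> nat) (cv : D -> nat),
    [/\ arc_colouring k ca, vertex_colouring k cv
      & joined_by_geodesics (total_rainbow ca cv)]).

(* Main.v *)
(* (a) In a directed triangle each arc composed with its successor is the only
   path of length 2 between its ends, so two colours do not suffice, while
   three colours suffice even for total-rainbow geodesics; blowing up one vertex
   into a complete digraph keeps both properties.

   (b) Join s blocks by making their cut vertices v_i a complete digraph. A path
   from block i to block j passes through v_i and v_j, so the v_i need distinct
   colours. Inside a block, a vertex leaves and is entered along routes using
   only the colours 3k, 3k+1, 3k+2, for each of the four values k < 4. Two of
   these triples avoid the colours i and j of v_i and v_j; they serve the two
   blocks, and a member of a third triple other than i and j colours v_i -> v_j.

   (c) For each pair p = (i, j) with i != j, the path u_p, v_i, v_j, w_p is the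
   unique geodesic from u_p to w_p, which again forces the v_i to have distinct
   colours. All other pairs u_p, w_q are adjacent, and every w_p reaches every
   u_q through a hub z, so the remaining geodesics can use constant colours. *)

From mathcomp Require Import all_boot.
From mathcomp Require Import zify.
Require Import Defs.

Set Implicit Arguments.
Unset Strict Implicit.
Unset Printing Implicit Defensive.

(** * Least values, rainbow paths and short geodesics *)

Lemma least_eq (P : nat -> Prop) (m : nat) :
  P m -> (forall k, P k -> m <= k) -> least P = m.
Proof.
move=> Pm minm; have [Pl minl] := leastP (ex_intro _ m Pm).
by apply/eqP; rewrite eqn_leq minl // minm.
Qed.

Section Digraphs.

Variable D : digraph.
Implicit Types (u v x y : D) (p : seq D).

Lemma joined_by_paths_sub (good good' : D -> seq D -> bool) :
  (forall u p, good u p -> good' u p) ->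
  joined_by_paths good -> joined_by_paths good'.
Proof.
by move=> sub joined u v; have [p uvp /sub gp] := joined u v; exists p.
Qed.

Lemma joined_by_geodesics_sub (good good' : D -> seq D -> bool) :
  (forall u p, good u p -> good' u p) ->
  joined_by_geodesics good -> joined_by_geodesics good'.
Proof.
by move=> sub joined u v; have [p uvp /sub gp] := joined u v; exists p.
Qed.

Lemma joined_by_geodesics_paths (good : D -> seq D -> bool) :
  joined_by_geodesics good -> joined_by_paths good.
Proof. by move=> joined u v; have [p [uvp _] gp] := joined u v; exists p. Qed.

Lemma joined_by_paths_strong (good : D -> seq D -> bool) :
  joined_by_paths good -> strongly_connected D.
Proof.
move=> joined u v; have [p /and3P [up /eqP lastp _] _] := joined u v.
by apply/connectP; exists p.
Qed.

Lemma total_rainbow_arc ca cv u p : total_rainbow ca cv u p -> rainbow ca u p.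
Proof. by rewrite /total_rainbow cat_uniq => /and3P []. Qed.

Lemma total_rainbow_vertex ca cv u p :
  total_rainbow ca cv u p -> vertex_rainbow cv u p.
Proof. by rewrite /total_rainbow cat_uniq => /and3P []. Qed.

Lemma mem_internal u p x :
  x \in u :: p -> x != u -> x != last u p -> x \in internal u p.
Proof.
case: p => [|y p]; first by rewrite inE => /= ->.
rewrite inE /internal /= => /orP [-> //|]; rewrite lastI mem_rcons inE.
by case/orP => [->|].
Qed.

Lemma vertex_rainbow_inj (c : D -> nat) u p x y :
  vertex_rainbow c u p -> x \in internal u p -> y \in internal u p ->
  c x = c y -> x = y.
Proof.
rewrite /vertex_rainbow; elim: (internal u p) => //= z q IH /andP [czq unq].
rewrite !inE => /predU1P [->|xq] /predU1P [->|yq] // eqc; last exact: IH.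
- by rewrite eqc map_f in czq.
- by rewrite -eqc map_f in czq.
Qed.

Lemma rainbow_size k (c : D -> D -> nat) u p :
  arc_colouring k c -> path (@arc D) u p -> rainbow c u p -> size p <= k.
Proof.
move=> ck up rp; rewrite -(size_pairmap c u p) -(size_iota 0 k).
apply: uniq_leq_size rp _ => m mp; rewrite mem_iota add0n /=.
elim: p u up mp => //= x p IH u /andP [ux xp].
by rewrite inE => /predU1P [->|]; [exact: ck | exact: IH].
Qed.

Lemma geodesic0 u : geodesic u u [::].
Proof. by split=> //; rewrite /dipath /= eqxx. Qed.

Lemma geodesic1 u v : arc u v -> geodesic u v [:: v].
Proof.
have [->|uv] := eqVneq u v; first by rewrite arc_irr.
move=> auv; split; first by rewrite /dipath /= auv eqxx inE uv.
by case=> // /and3P [_ /=]; rewrite (negbTE uv).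
Qed.

Lemma geodesic2 u x v :
  u != v -> ~~ arc u v -> arc u x -> arc x v -> geodesic u v [:: x; v].
Proof.
move=> uv nuv ux xv; split.
  rewrite /dipath /= ux xv eqxx !inE negb_or uv /= !andbT.
  by apply/andP; split; apply/eqP => e; move: ux xv; rewrite e arc_irr.
case=> [|y [|//]] /and3P [/= + /eqP /= e]; first by rewrite e eqxx in uv.
by rewrite e (negbTE nuv).
Qed.

(** The hypotheses also force distinct vertices: a repetition would give a loop or the arc from [u]
    to [v]. *)
Lemma geodesic3 u x y v :
  u != v -> ~~ arc u v -> (forall t, arc u t -> ~~ arc t v) ->
  arc u x -> arc x y -> arc y v -> geodesic u v [:: x; y; v].
Proof.
move=> uv nuv n2 ux xy yv; split.
  rewrite /dipath /= ux xy yv eqxx !inE !negb_or uv /= !andbT.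
  apply/and3P; split; [apply/andP; split | apply/andP; split | ];
    apply/eqP => e.
  - by rewrite e arc_irr in ux.
  - by move: nuv; rewrite e yv.
  - by rewrite e arc_irr in xy.
  - by move: nuv; rewrite -e ux.
  - by rewrite e arc_irr in yv.
case=> [|t [|t' [|//]]] /and3P [/= + /eqP /= e]; first by rewrite e eqxx in uv.
  by rewrite e (negbTE nuv).
by rewrite e => /and3P [/n2 /negbTE ->].
Qed.

End Digraphs.

(** * Parameter values from one colouring and one lower bound *)

Section RainbowBounds.

Variables (D : digraph) (s : nat).

(** Total-rainbow geodesics are the strongest of the four demands and rainbow paths the weakest, so
    an upper bound for the former and a lower bound for the latter fix all four values. *)
Lemma rainbow_parameters_eq (ca : D -> D -> nat) (cv : D -> nat) :
  arc_colouring s ca -> vertex_colouring s cv ->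
  joined_by_geodesics (total_rainbow ca cv) ->
  (forall k (c : D -> D -> nat), arc_colouring k c ->
     joined_by_paths (rainbow c) -> s <= k) ->
  strongly_connected D /\ [/\ trc D = s, strc D = s, rc D = s & src D = s].
Proof.
move=> cas cvs joined low.
have joinedP := joined_by_geodesics_paths joined.
split; first exact: joined_by_paths_strong joinedP.
split; apply: least_eq.
- by exists ca, cv.
- move=> k [c [c' [ck _ j]]]; apply: low ck _.
  exact: joined_by_paths_sub (@total_rainbow_arc _ _ _) j.
- by exists ca, cv.
- move=> k [c [c' [ck _ /joined_by_geodesics_paths j]]]; apply: low ck _.
  exact: joined_by_paths_sub (@total_rainbow_arc _ _ _) j.
- exists ca; split=> //.
  exact: joined_by_paths_sub (@total_rainbow_arc _ _ _) joinedP.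
- by move=> k [c [ck j]]; apply: low ck j.
- exists ca; split=> //.
  exact: joined_by_geodesics_sub (@total_rainbow_arc _ _ _) joined.
- by move=> k [c [ck /joined_by_geodesics_paths j]]; apply: low ck j.
Qed.

Lemma trc_rvc_eq (ca : D -> D -> nat) (cv : D -> nat) :
  arc_colouring s ca -> vertex_colouring s cv ->
  joined_by_paths (total_rainbow ca cv) ->
  (forall k (c : D -> nat), vertex_colouring k c ->
     joined_by_paths (vertex_rainbow c) -> s <= k) ->
  strongly_connected D /\ trc D = s /\ rvc D = s.
Proof.
move=> cas cvs joined low; split; first exact: joined_by_paths_strong joined.
split; apply: least_eq.
- by exists ca, cv.
- move=> k [c [c' [_ ck j]]]; apply: low ck _.
  exact: joined_by_paths_sub (@total_rainbow_vertex _ _ _) j.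
- exists cv; split=> //.
  exact: joined_by_paths_sub (@total_rainbow_vertex _ _ _) joined.
- by move=> k [c [ck j]]; apply: low ck j.
Qed.

Lemma strc_srvc_eq (ca : D -> D -> nat) (cv : D -> nat) :
  arc_colouring s ca -> vertex_colouring s cv ->
  joined_by_geodesics (total_rainbow ca cv) ->
  (forall k (c : D -> nat), vertex_colouring k c ->
     joined_by_geodesics (vertex_rainbow c) -> s <= k) ->
  strongly_connected D /\ strc D = s /\ srvc D = s.
Proof.
move=> cas cvs joined low; split.
  exact: joined_by_paths_strong (joined_by_geodesics_paths joined).
split; apply: least_eq.
- by exists ca, cv.
- move=> k [c [c' [_ ck j]]]; apply: low ck _.
  exact: joined_by_geodesics_sub (@total_rainbow_vertex _ _ _) j.
- exists cv; split=> //.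
  exact: joined_by_geodesics_sub (@total_rainbow_vertex _ _ _) joined.
- by move=> k [c [ck j]]; apply: low ck j.
Qed.

Lemma injective_colours (c : D -> nat) (f : 'I_s -> D) k :
  vertex_colouring k c -> injective (c \o f) -> s <= k.
Proof.
move=> ck inj; pose g i := Ordinal (ck (f i)).
rewrite -(card_ord s) -(card_ord k); apply: (@leq_card _ _ g).
by move=> i j /(congr1 val) /inj.
Qed.

End RainbowBounds.

(** * The blown-up triangle *)

Section BlownUpTriangle.

Variable n : nat.

Definition tri_vert : finType := ('I_n.+1 + bool)%type.

Definition tri_arc (x y : tri_vert) : bool :=
  match x, y with
  | inl i, inl j => i != j
  | inl _, inr false => true
  | inr false, inr true => true
  | inr true, inl _ => true
  | _, _ => false
  end.

Lemma tri_arc_irr : irreflexive tri_arc.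
Proof. by case=> [i|[]] //=; rewrite eqxx. Qed.

Definition triangle : digraph := Digraph tri_arc_irr.

(** Arcs are coloured by the class of their tail, so a path through all three classes has arcs of
    two colours; [tri_cv] gives its middle vertex the third. *)
Definition tri_ca (x y : triangle) : nat :=
  match x with inl _ => 0 | inr false => 1 | inr true => 2 end.

Definition tri_cv (x : triangle) : nat :=
  match x with inl _ => 1 | inr false => 2 | inr true => 0 end.

Lemma tri_joined : joined_by_geodesics (total_rainbow tri_ca tri_cv).
Proof.
pose b : triangle := inr false; pose c : triangle := inr true.
pose a : triangle := inl ord0.
move=> u v; have [->|uv] := eqVneq u v.
  by exists [::] => //; exact: geodesic0.
have [auv|nuv] := boolP (arc u v).
  by exists [:: v] => //; exact: geodesic1.
pose m := match u with inl _ => b | inr false => c | inr true => a end.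
suff [um mv rm] :
    [/\ arc u m, arc m v & total_rainbow tri_ca tri_cv u [:: m; v]].
  by exists [:: m; v]; first exact: geodesic2.
by rewrite {}/m; case: u v uv nuv => [i|[]] [j|[]] //= ne;
  rewrite /= negbK => /eqP e; rewrite e eqxx in ne.
Qed.

Lemma tri_lower k (c : triangle -> triangle -> nat) :
  arc_colouring k c -> joined_by_paths (rainbow c) -> 3 <= k.
Proof.
move=> ck joined; rewrite ltnNge; apply/negP => k2.
have two u v : u != v -> ~~ arc u v ->
    exists m, [/\ arc u m, arc m v & c u m != c m v].
  move=> uv nuv; have [p /and3P [up /eqP lastp _] rp] := joined u v.
  have := leq_trans (rainbow_size ck up rp) k2.
  case: p up lastp rp => [_ /= e|x [|y [|//]]] /=.
    by rewrite e eqxx in uv.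
    by rewrite andbT => ux e; case/negP: nuv; rewrite -e.
  rewrite andbT => /andP [ux xy] <-; rewrite /rainbow /= inE andbT => cuxy _.
  by exists x.
pose b : triangle := inr false; pose d : triangle := inr true.
(* The path from [d] to [b] selects a clique vertex [a]. The paths from [a] to [d] and from [b] to
   [a] are then forced, so the three arcs on [a], [b], [d] differ pairwise in colour. *)
have [[i|[]] [] // _ _ cdb] := two d b isT isT.
set a : triangle := inl i in cdb.
have cad : c a b != c b d by have [[j|[]] []] := two a d isT isT.
have cba : c b d != c d a by have [[j|[]] []] := two b a isT isT.
by move: (ck a b isT) (ck b d isT) (ck d a isT); lia.
Qed.

(** The order separates the members of the family up to isomorphism. *)
Lemma card_triangle : #|triangle| = n.+3.
Proof. by rewrite card_sum card_ord card_bool addn2. Qed.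

End BlownUpTriangle.

(** * Blocks joined at cut vertices *)

Definition avoid (a b c i j : nat) : nat :=
  if a \notin [:: i; j] then a else if b \notin [:: i; j] then b else c.

Lemma avoidP a b c i j (m := avoid a b c i j) :
  uniq [:: a; b; c] -> [/\ m \in [:: a; b; c], m != i & m != j].
Proof.
rewrite {}/m /avoid /= !inE => abc.
by case: ifP; [|case: ifP]; split; lia.
Qed.

Section Blocks.

Variable s : nat.

(* [(i, None)] is the cut vertex v_i. *)
Definition block_vert : finType := ('I_s * option ('I_4 * bool))%type.

Definition block_arc (x y : block_vert) : bool :=
  if x.1 == y.1 then x.2 != y.2 else (x.2 == None) && (y.2 == None).

Lemma block_arc_irr : irreflexive block_arc.
Proof. by move=> x; rewrite /block_arc !eqxx. Qed.

Definition blocks : digraph := Digraph block_arc_irr.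

Definition cut (i : 'I_s) : blocks := (i, None).

(** An arc between different blocks joins two cut vertices, so a path leaves its first block and
    enters its last one through theirs. *)
Lemma path_cut (u : blocks) (p : seq blocks) :
  path (@arc blocks) u p -> u.1 != (last u p).1 ->
  (cut u.1 \in u :: p) && (cut (last u p).1 \in u :: p).
Proof.
elim: p u => [u|y p IH u] /=; first by rewrite eqxx.
case/andP => uy yp ul; rewrite /arc /= /block_arc in uy.
have [e|ne] := eqVneq u.1 y.1.
  by rewrite e in ul *; have /andP [h1 h2] := IH y yp ul;
    rewrite !(in_cons u) h1 h2 !orbT.
move: uy; rewrite (negbTE ne) => /andP [/eqP u2 /eqP y2].
have cutE (x : blocks) : x.2 = None -> cut x.1 = x by case: x => ? ? /= ->.
rewrite (cutE u) // mem_head /=.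
have [e|ne'] := eqVneq y.1 (last y p).1.
  by rewrite -e (cutE y) // !inE eqxx orbT.
by have /andP [_ h] := IH y yp ne'; rewrite in_cons h orbT.
Qed.

Lemma block_lower k (c : blocks -> nat) :
  vertex_colouring k c -> joined_by_paths (vertex_rainbow c) -> s <= k.
Proof.
move=> ck joined; apply: (injective_colours (f := cut) ck) => i j /= eqc.
apply/eqP/negP => /negP ij.
(* Ends that are not cut vertices make both cut vertices internal. *)
have [p /and3P [up /eqP lastp _] rp] :=
  joined (i, Some (ord0, true)) (j, Some (ord0, true)).
have := path_cut up; rewrite lastp => /(_ ij) /= /andP [ip jp].
suff [] : cut i = cut j by move/eqP; rewrite (negbTE ij).
by apply: vertex_rainbow_inj rp _ _ eqc; apply: mem_internal => //;
  rewrite ?lastp; apply/eqP; case.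
Qed.

Hypothesis s_ge13 : 13 <= s.

Definition triple (k : nat) : seq nat := [:: 3 * k; 3 * k + 1; 3 * k + 2].

Lemma mem_triple k m : (m \in triple k) = (m %/ 3 == k).
Proof. by rewrite !inE; lia. Qed.

Lemma triple_uniq k : uniq (triple k).
Proof. by rewrite /= !inE; lia. Qed.

(** Used with the indices [i %/ 3] and [j %/ 3] of the triples of i and j: these exclude at most two
    of the four values. *)
Lemma two_others (x y : nat) : exists k l m : 'I_4,
  [/\ uniq [:: k; l; m], x != k, x != l, y != k & y != l].
Proof.
pose o0 := @Ordinal 4 0 isT; pose o1 := @Ordinal 4 1 isT.
pose o2 := @Ordinal 4 2 isT; pose o3 := @Ordinal 4 3 isT.
case: x y => [|[|[|[|x]]]] [|[|[|[|y]]]];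
first [ by exists o0, o1, o2 | by exists o0, o2, o1 | by exists o0, o3, o1
      | by exists o1, o2, o0 | by exists o1, o3, o0 | by exists o2, o3, o0 ].
Qed.

(** The implication is boolean and covers i = j, so that [xchoose] applies to all i and j. The
    triple [t.1.1] serves for leaving, [t.1.2] for entering, and [t.2] colours the arc from v_i to
    v_j. *)
Lemma exists_routing i j : exists t : 'I_4 * 'I_4 * 'I_12,
  (i != j) ==> uniq ([:: i; j; nat_of_ord t.2] ++ triple t.1.1 ++ triple t.1.2).
Proof.
have [k [l [m [klm ik il jk jl]]]] := two_others (i %/ 3) (j %/ 3).
have /and3P [kl km lm] : [&& k != l :> nat, k != m :> nat & l != m :> nat].
  by move: klm; rewrite /= !inE negb_or andbT -andbA.
(* The triple of [m] may contain i or j, but two values cannot exhaust its three members. *)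
have [] := @avoidP _ _ _ i j (triple_uniq m).
set d := avoid _ _ _ _ _; rewrite mem_triple => /eqP dm di dj.
have d12 : d < 12 by have := ltn_ord m; lia.
exists (k, l, Ordinal d12); apply/implyP => ij.
change (uniq ([:: i; j; d] ++ triple k ++ triple l)).
have kl_uniq : uniq (triple k ++ triple l).
  rewrite cat_uniq !triple_uniq andbT; apply/hasPn => n.
  by rewrite !mem_triple => /eqP ->; rewrite eq_sym.
rewrite 3!cat_cons cat0s 3!cons_uniq kl_uniq 3!in_cons !mem_cat !mem_triple.
rewrite !negb_or ij (eq_sym i) (eq_sym j) di dj dm ik il jk jl.
by rewrite eq_sym km eq_sym lm.
Qed.

Definition routing i j : 'I_4 * 'I_4 * 'I_12 := xchoose (exists_routing i j).

Lemma routingP i j (t := routing i j) :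
  i != j -> uniq ([:: i; j; nat_of_ord t.2] ++ triple t.1.1 ++ triple t.1.2).
Proof. by apply/implyP; exact: (xchooseP (exists_routing i j)). Qed.

(* An arc inside a block takes its colour from the vertex playing the
   intermediate role: routes towards v_i stay on the same side [b] and routes
   from v_i change sides, so an arc never has to serve both kinds of route. *)
Definition block_ca (x y : blocks) : nat :=
  match x.2, y.2 with
  | None, None => (routing x.1 y.1).2
  | Some (k, _), None | None, Some (k, _) => 3 * k + 2
  | Some (k, b), Some (l, b') => if b == b' then 3 * l else 3 * k
  end.

Definition block_cv (x : blocks) : nat :=
  if x.2 is Some (k, _) then 3 * k + 1 else x.1.

(** Unless already of index [k], a non-cut vertex makes a detour through one, with colours 3k, 3k+1,
    3k+2 in this order. *)
Definition route_out (k : 'I_4) (x : blocks) : seq blocks :=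
  match x.2 with
  | None => [::]
  | Some (k', b) =>
      if k == k' then [:: cut x.1] else [:: (x.1, Some (k, b)); cut x.1]
  end.

(** The detour meets the colours 3l+2, 3l+1, 3l; changing sides makes its last arc take its colour
    from [l]. *)
Definition route_in (l : 'I_4) (y : blocks) : seq blocks :=
  match y.2 with
  | None => [::]
  | Some (l', b) => if l == l' then [:: y] else [:: (y.1, Some (l, ~~ b)); y]
  end.

Lemma block_joined : joined_by_paths (total_rainbow block_ca block_cv).
Proof.
move=> u v; have [->|uv] := eqVneq u v.
  by exists [::]; first by case: (geodesic0 v).
case: u v uv => [i x] [j y] uv; have [eij|ij] := eqVneq i j.
  exists [:: (j, y)] => //; case: (@geodesic1 blocks (i, x) (j, y)) => //.
  rewrite /arc /= /block_arc /= eij eqxx.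
  by apply: contraNneq uv => ->; rewrite eij.
have := routingP ij; case Er: (routing i j) => [[k l] d] /=.
rewrite !inE !negb_or -!andbA andbT.
(* Nine distinct colours give 36 inequalities. *)
do 35! [case/andP => ?]; move=> ?.
have neS (m m' : 'I_4) (c c' : bool) :
    m != m' -> (Some (m, c) == Some (m', c')) = false.
  by move=> /eqP mm; apply/eqP => -[].
have negb_neq (c : bool) : (~~ c == c) = false by case: c.
exists (route_out k (i, x) ++ cut j :: route_in l (j, y)).
  rewrite /dipath /route_out /route_in /cut.
  case: x uv => [[k' b]|] _ /=; [case: (eqVneq k' k) => [->|kk'] /= | ];
  case: y => [[l' b']|] /=; try (case: (eqVneq l l') => [<-|ll'] /=);
  by rewrite /arc /= /block_arc ?inE ?xpair_eqE /= ?eqxx ?(negbTE ij) /= ?neS.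
rewrite /total_rainbow /route_out /route_in /cut.
case: x uv => [[k' b]|] _ /=; [case: (eqVneq k' k) => [->|kk'] /= | ];
case: y => [[l' b']|] /=; try (case: (eqVneq l l') => [<-|ll'] /=);
rewrite /internal /block_ca /block_cv /= ?Er ?eqxx ?negb_neq ?inE /=;
rewrite ?negb_or -?andbA ?andbT;
by do ?[apply/andP; split]; rewrite // eq_sym.
Qed.

Lemma block_ca_bound : arc_colouring s block_ca.
Proof.
case=> i x [j y] _; rewrite /block_ca /=.
case: x y => [[k b]|] [[l b']|]; last by have := ltn_ord (routing i j).2; lia.
all: try case: (b == b'); try have := ltn_ord k; try have := ltn_ord l; lia.
Qed.

Lemma block_cv_bound : vertex_colouring s block_cv.
Proof.
case=> i [[k b]|]; last exact: ltn_ord.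
by rewrite /block_cv /=; have := ltn_ord k; lia.
Qed.

End Blocks.

(** * Forced geodesics *)

Section ForcedGeodesics.

Variable s : nat.
Hypothesis s_ge13 : 13 <= s.

Definition geo_pair : finType := ('I_s * 'I_s)%type.

Definition geo_vert : finType := (('I_s + geo_pair) + (geo_pair + unit))%type.

(* The pairs (i, i) are kept, with u_(i,i) adjacent to all w_q and w_(i,i)
   adjacent from all u_p, so that paths through z can always use one of them. *)
Definition geo_arc (x y : geo_vert) : bool :=
  match x, y with
  | inl (inl i), inl (inl j) => i != j
  | inl (inr p), inl (inl i) => p.1 == i
  | inl (inl i), inr (inl p) => p.2 == i
  | inl (inr p), inr (inl q) => (p != q) || (p.1 == p.2)
  | inr (inl _), inr (inr _) => true
  | inr (inr _), inl (inr _) => true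
  | _, _ => false
  end.

Lemma geo_arc_irr : irreflexive geo_arc.
Proof. by case=> [[i|p]|[p|[]]] //=; rewrite eqxx. Qed.

Definition geo : digraph := Digraph geo_arc_irr.

Definition Gv (i : 'I_s) : geo := inl (inl i).
Definition Gu (p : geo_pair) : geo := inl (inr p).
Definition Gw (p : geo_pair) : geo := inr (inl p).
Definition Gz : geo := inr (inr tt).

(* Along u_p, w_q, z, u_r the vertices and arcs use the colours 0, ..., 5 once
   each; the colours of the arcs at a v_i are disjoint from those of the paths
   through z that these arcs prolong. *)
Definition geo_ca (x y : geo) : nat :=
  match x, y with
  | inl (inl i), inl (inl j) => avoid 6 7 8 i j
  | inl (inr p), inl (inl i) => avoid 0 1 9 p.1 p.2
  | inl (inl i), inr (inl p) => avoid 10 11 12 p.1 p.2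
  | inl (inr _), inr (inl _) => 0
  | inr (inl _), inr (inr _) => 2
  | _, _ => 4
  end.

Definition geo_cv (x : geo) : nat :=
  match x with
  | inl (inl i) => i
  | inl (inr _) => 5
  | inr (inl _) => 1
  | inr (inr _) => 3
  end.

Lemma geo_ca_bound : arc_colouring s geo_ca.
Proof.
have lt_avoid a b c i j : uniq [:: a; b; c] ->
    [/\ a < s, b < s & c < s] -> avoid a b c i j < s.
  move=> abc [sa sb sc]; have [+ _ _] := avoidP i j abc.
  by rewrite !inE => /or3P [] /eqP ->.
case=> [[i|p]|[p|[]]] [[j|q]|[q|[]]] _ //=; try lia.
all: by apply: lt_avoid => //; split; lia.
Qed.

Lemma geo_cv_bound : vertex_colouring s geo_cv.
Proof. by case=> [[i|p]|[p|[]]] /=; rewrite ?ltn_ord //; lia. Qed.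

Lemma geo_joined : joined_by_geodesics (total_rainbow geo_ca geo_cv).
Proof.
move=> u v; have [->|uv] := eqVneq u v.
  by exists [::] => //; exact: geodesic0.
have [auv|nuv] := boolP (arc u v).
  by exists [:: v] => //; exact: geodesic1.
have avP a b c (i j : 'I_s) := @avoidP a b c i j.
have g2 x := @geodesic2 geo u x v uv nuv.
have g3 x y := @geodesic3 geo u x y v uv nuv.
case: u v uv nuv g2 g3 => [[i|p]|[p|[]]] [[j|q]|[q|[]]] //= uv nuv g2 g3.
- by case/eqP: uv; move: nuv; rewrite negbK => /eqP ->.
- exists [:: Gw (i, i); Gz; Gu q].
    by apply: g3 => //=; case=> [[?|?]|[?|[]]] //=; rewrite ?eqxx.
  have [] := avP 10 11 12 i i isT.
  by rewrite /total_rainbow /internal /= !inE; lia.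
- have qi : i != q.2 by rewrite eq_sym.
  exists [:: Gv q.2; Gw q]; first by apply: g2 => /=.
  have [] := avP 10 11 12 q.1 q.2 isT; have [] := avP 6 7 8 i q.2 isT.
  by rewrite /total_rainbow /internal /= !inE; lia.
- exists [:: Gw (i, i); Gz]; first by apply: g2 => /=.
  have [] := avP 10 11 12 i i isT.
  by rewrite /total_rainbow /internal /= !inE; lia.
- exists [:: Gv p.1; Gv j]; first by apply: g2 => /=.
  have [] := avP 0 1 9 p.1 p.2 isT; have [] := avP 6 7 8 p.1 j isT.
  by rewrite /total_rainbow /internal /= !inE; lia.
- exists [:: Gw (p.1, p.1); Gz; Gu q] => //.
  apply: g3 => //=; first by case=> [[?|?]|[?|[]]].
  by case: eqP => //= -> /=.
(* The forced case, w_p from u_p with distinct coordinates: the three arc colours come from disjoint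
   lists and avoid the colours of both internal vertices. *)
- move: nuv; rewrite negb_or negbK => /andP [/eqP pq np].
  rewrite -{}pq in uv g2 g3 *.
  exists [:: Gv p.1; Gv p.2; Gw p].
    apply: g3 => //=; case=> [[?|?]|[?|[]]] //= /eqP <-.
    by rewrite eq_sym.
  have [] := avP 0 1 9 p.1 p.2 isT; have [] := avP 6 7 8 p.1 p.2 isT.
  have [] := avP 10 11 12 p.1 p.2 isT.
  rewrite -val_eqE /= in np.
  by rewrite /total_rainbow /internal /= !inE; lia.
- exists [:: Gw (p.1, p.1); Gz] => //; apply: g2 => //=.
  by case: eqP => //= -> /=.
- exists [:: Gz; Gu (j, j); Gv j].
    by apply: g3 => //=; case=> [[?|?]|[?|[]]].
  have [] := avP 0 1 9 j j isT.
  by rewrite /total_rainbow /internal /= !inE; lia.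
- by exists [:: Gz; Gu q] => //; apply: g2.
- exists [:: Gz; Gu (q.1, q.1); Gw q] => //.
  apply: g3 => //=; first by case=> [[?|?]|[?|[]]].
  by rewrite eqxx orbT.
- exists [:: Gu (j, j); Gv j]; first by apply: g2 => /=.
  have [] := avP 0 1 9 j j isT.
  by rewrite /total_rainbow /internal /= !inE; lia.
- exists [:: Gu (q.1, q.1); Gw q] => //; apply: g2 => //=.
  by rewrite eqxx orbT.
Qed.

Lemma geo_lower k (c : geo -> nat) :
  vertex_colouring k c -> joined_by_geodesics (vertex_rainbow c) -> s <= k.
Proof.
move=> ck joined; apply: (injective_colours (f := Gv) ck) => i j /= eqc.
apply/eqP/negP => /negP ij.
have [p [/and3P [up /eqP lastp _] minp] rp] := joined (Gu (i, j)) (Gw (i, j)).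
have size_p : size p <= 3.
  apply: (minp [:: Gv i; Gv j; Gw (i, j)]).
  by rewrite /dipath /= !eqxx ij inE orbF /= andbT; exact: ij.
(* One arc is missing and two arcs would need i = j. With three arcs, a first step to some w_q leads
   on only to z, which has no arc to a w; so the path runs through v_i and v_j. *)
case: p up lastp rp size_p {minp} => [|x [|y [|t [|//]]]] //=.
- by rewrite andbT => /[swap] ->; rewrite /arc /= eqxx (negbTE ij).
- rewrite andbT => /[swap] ->; rewrite /arc /=.
  by case: x => [[l|q]|[q|[]]] /andP [] //= /eqP <-; rewrite eq_sym (negbTE ij).
rewrite andbT => /[swap] ->; rewrite /arc /=.
case: x => [[l|q]|[q|[]]] /and3P [] //=; last by case: y => [[?|?]|[?|[]]].
move=> /eqP <-; case: y => [[m|?]|[?|[]]] //= _ /eqP <-.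
by rewrite /vertex_rainbow /= inE eqc eqxx.
Qed.

End ForcedGeodesics.

Theorem theorem7 :
  (exists D : nat -> digraph,
     (forall m n : nat, m <> n -> ~ isomorphic (D m) (D n)) /\
     (forall n : nat, strongly_connected (D n) /\
        [/\ trc (D n) = 3, strc (D n) = 3, rc (D n) = 3 & src (D n) = 3])) /\
  (forall s : nat, 13 <= s ->
     exists D : digraph, strongly_connected D /\ trc D = s /\ rvc D = s) /\
  (forall s : nat, 13 <= s ->
     exists D : digraph, strongly_connected D /\ strc D = s /\ srvc D = s).
Proof.
split; [|split].
- exists triangle; split=> [m n mn [f [/bij_eq_card]]|n].
    by rewrite !card_triangle => -[].
  apply: (@rainbow_parameters_eq _ _ (@tri_ca n) (@tri_cv n)).
  + by move=> [?|[]] ?.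
  + by case=> [?|[]].
  + exact: tri_joined.
  + exact: tri_lower.
- move=> s s13; exists (blocks s).
  exact: trc_rvc_eq (block_ca_bound s13) (block_cv_bound s13)
    (block_joined s13) (@block_lower s).
- move=> s s13; exists (geo s).
  exact: strc_srvc_eq (geo_ca_bound s13) (geo_cv_bound s13)
    (geo_joined s13) (@geo_lower s).
Qed.
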